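(* Let $p$ be an odd prime, $f(x)\in\mathbb{Z}[x]$, $n\ge2$, and let $\sigma$ be a cycle of $f_n$ which grows. Then its unique lift $\tilde\sigma$, a cycle of $f_{n+1}$, also grows; consequently the lift of $\tilde\sigma$ also grows, and so on for all successive lifts.
   Context: $f_n:\mathbb{Z}/p^n\mathbb{Z}\to\mathbb{Z}/p^n\mathbb{Z}$ is the map $x\mapsto f(x)\bmod p^n$. Let $\sigma=(x_1,\dots,x_k)$ be a cycle of $f_n$ of length $k$ (distinct elements, $f_n(x_i)=x_{i+1}$, $f_n(x_k)=x_1$), with the $x_i$ viewed as integers representing their classes. Put $g=f^k$ ($k$-th iterate), $a_n=g'(x_1)$, $b_n=(g(x_1)-x_1)/p^n$. A lift of $\sigma$ is a cycle of $f_{n+1}$ all of whose elements reduce mod $p^n$ to elements of $\sigma$. The cycle $\sigma$ grows if $a_n\equiv1\pmod p$ and $b_n\not\equiv0\pmod p$ (this is independent of the choices); in that case the elements of $\mathbb{Z}/p^{n+1}\mathbb{Z}$ reducing to elements of $\sigma$ form a single cycle of $f_{n+1}$, of length $pk$, which is the unique lift of $\sigma$. *)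

(* Defs.v *)
From mathcomp Require Import all_boot all_order all_algebra.
Set Implicit Arguments.
Unset Strict Implicit.
Unset Printing Implicit Defensive.
Import GRing.Theory.
Local Open Scope ring_scope.

(* 'Z_(p ^ n) is Z/p^nZ only when 1 < p ^ n, so all the notions below are
   meant for p prime and 0 < n. *)

(* f_n : x |-> f(x) mod p^n *)
Definition fmod (f : {poly int}) (p n : nat) (x : 'Z_(p ^ n)) : 'Z_(p ^ n) :=
  (map_poly intr f).[x].

Definition residues (p n : nat) (s : seq int) : seq 'Z_(p ^ n) :=
  [seq x%:~R | x <- s].

(* A cycle (x_1, ..., x_k) of f_n is given by a sequence of arbitrary integers
   representing the classes x_1, ..., x_k; quantifying over such sequences
   quantifies over all choices of representatives and of a first element. *)
Definition is_cycle (f : {poly int}) (p n : nat) (s : seq int) : Prop :=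
  s <> [::] /\ ufcycle (fmod f (n := n)) (residues p n s).

(* Two sequences of representatives define the same cycle: their residues
   coincide up to the choice of the first element. *)
Definition same_cycle (p n : nat) (s t : seq int) : Prop :=
  exists r : nat, residues p n t = rot r (residues p n s).

Definition iterp (f : {poly int}) (k : nat) : {poly int} :=
  iter k (fun q => f \Po q) 'X.

Definition cycle_a (f : {poly int}) (s : seq int) : int :=
  (iterp f (size s))^`().[head 0 s].

(* The division is exact when s is a cycle of f_n. *)
Definition cycle_b (f : {poly int}) (p n : nat) (s : seq int) : int :=
  (((iterp f (size s)).[head 0 s] - head 0 s) %/ (p ^ n)%N%:Z)%Z.

Definition grows (f : {poly int}) (p n : nat) (s : seq int) : Prop :=
  (cycle_a f s = 1 %[mod p%:Z])%Z /\ (cycle_b f p n s <> 0 %[mod p%:Z])%Z.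

(* t is a cycle of f_(n+1) lying above the cycle s of f_n. *)
Definition is_lift (f : {poly int}) (p n : nat) (s t : seq int) : Prop :=
  is_cycle f p n.+1 t /\ {subset residues p n t <= residues p n s}.

Definition has_unique_lift (f : {poly int}) (p n : nat) (s : seq int) : Prop :=
  exists2 t : seq int, is_lift f p n s t &
    forall t' : seq int, is_lift f p n s t' -> same_cycle p n.+1 t t'.

(* t, a cycle of f_(n+m), is reached from the cycle s of f_n by m successive
   lifts. *)
Fixpoint iterated_lift (f : {poly int}) (p n : nat) (s : seq int) (m : nat)
    (t : seq int) : Prop :=
  if m is m'.+1 then
    exists2 u : seq int, iterated_lift f p n s m' u & is_lift f p (n + m') u t
  else t = s.

(* Main.v *)
Require Import Defs.
From mathcomp Require Import all_boot all_order all_algebra.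
From mathcomp Require Import ring zify.
Set Implicit Arguments.
Unset Strict Implicit.
Unset Printing Implicit Defensive.
Import Order.TTheory GRing.Theory Num.Theory.
Local Open Scope ring_scope.

(** Put g = f^k and a = g'(x), where x = x_1 and g(x) = x + p^n b. Taylor
    expansion gives g^j(x) = x + p^n b (1 + a + ... + a^(j-1)) mod p^(2n). As
    a = 1 mod p, the geometric sum is j mod p, so that x has period exactly
    p k modulo p^(n+1), and for odd p the sum is p mod p^2 when j = p. Since
    2n >= n + 2, this yields g^p(x) = x + p^(n+1) b mod p^(n+2): the lift
    grows with b_(n+1) = b_n mod p. *)

(** * Taylor expansion, congruences and iterates of integer polynomials *)

(** Only the divisibility of the remainder by h^2 is ever used, so r stays unspecified and no f''/2
    appears. *)
Lemma horner_taylor2 (R : comNzRingType) (f : {poly R}) (x h : R) :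
  exists r, f.[x + h] = f.[x] + h * f^`().[x] + h ^+ 2 * r.
Proof.
elim/poly_ind: f => [|f c [r IHf]].
  by exists 0; rewrite deriv0 !horner0 !mulr0 !addr0.
exists (f^`().[x] + r * (x + h)).
rewrite derivMXaddC !hornerMXaddC hornerD hornerMX IHf.
ring.
Qed.

Lemma dvdz_horner_sub (f : {poly int}) (d x y : int) :
  (d %| x - y)%Z -> (d %| f.[x] - f.[y])%Z.
Proof.
move=> dxy; have [r] := horner_taylor2 f y (x - y).
rewrite addrC subrK => ->.
have -> : f.[y] + (x - y) * f^`().[y] + (x - y) ^+ 2 * r - f.[y]
        = (x - y) * (f^`().[y] + (x - y) * r) by ring.
exact: dvdz_mulr.
Qed.

Lemma dvdz_subC (d x y : int) : (d %| x - y)%Z = (d %| y - x)%Z.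
Proof. by rewrite -opprB rpredN. Qed.

Lemma dvdz_sub_trans (d y x z : int) :
  (d %| x - y)%Z -> (d %| y - z)%Z -> (d %| x - z)%Z.
Proof. by move=> xy yz; rewrite -(subrKA y) rpredD. Qed.

Lemma iterpD (f : {poly int}) i j : iterp f (i + j) = iterp f i \Po iterp f j.
Proof.
elim: i => [|i IHi]; first by rewrite /iterp /= comp_polyX.
by rewrite addSn /= -/(iterp _ _) IHi comp_polyA.
Qed.

Lemma iterpM (f : {poly int}) i j : iterp f (i * j) = iterp (iterp f j) i.
Proof. by elim: i => // i IHi; rewrite mulSn iterpD IHi. Qed.

Lemma iterp0_horner (f : {poly int}) x : (iterp f 0).[x] = x.
Proof. exact: hornerX. Qed.

Lemma iterpS_horner (f : {poly int}) i x :
  (iterp f i.+1).[x] = f.[(iterp f i).[x]].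
Proof. by rewrite /= horner_comp. Qed.

Lemma iterpD_horner (f : {poly int}) i j x :
  (iterp f (i + j)).[x] = (iterp f i).[(iterp f j).[x]].
Proof. by rewrite iterpD horner_comp. Qed.

Lemma iterp1 (f : {poly int}) : iterp f 1 = f.
Proof. by rewrite /iterp /= comp_polyXr. Qed.

Lemma deriv_iterpD (f : {poly int}) i j x :
  (iterp f (i + j))^`().[x]
    = (iterp f i)^`().[(iterp f j).[x]] * (iterp f j)^`().[x].
Proof. by rewrite iterpD deriv_comp hornerM horner_comp. Qed.

(** * Displacement of iterates and geometric sums *)

(** Induction on j: the Taylor expansion of g at y turns the partial sum S into 1 + g'(y) S, with a
    remainder divisible by (g(y) - y)^2. *)
Lemma iterp_geometric (g : {poly int}) (q y : int) j : (q %| g.[y] - y)%Z ->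
  (q ^+ 2 %| (iterp g j).[y]
     - (y + (g.[y] - y) * \sum_(i < j) g^`().[y] ^+ i))%Z.
Proof.
move=> qgy; elim: j => [|j IHj].
  by rewrite iterp0_horner big_ord0 mulr0 addr0 subrr.
rewrite iterpS_horner; apply: dvdz_sub_trans (dvdz_horner_sub g IHj) _.
have [r ->] := horner_taylor2 g y ((g.[y] - y) * \sum_(i < j) g^`().[y] ^+ i).
rewrite big_ord_recl expr0.
under [X in 1 + X]eq_bigr => i _ do rewrite lift0 exprS.
rewrite -mulr_sumr; set S := \sum_(i < j) _.
have -> : g.[y] + (g.[y] - y) * S * g^`().[y] + ((g.[y] - y) * S) ^+ 2 * r
   - (y + (g.[y] - y) * (1 + g^`().[y] * S))
   = (g.[y] - y) ^+ 2 * (S ^+ 2 * r) by ring.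
by apply: dvdz_mulr; apply: dvdz_exp2r.
Qed.

Lemma sum_expr_mod (p a : int) j : (p %| a - 1)%Z ->
  (p %| \sum_(i < j) a ^+ i - j%:Z)%Z.
Proof.
move=> pa; elim: j => [|j IHj]; first by rewrite big_ord0.
rewrite big_ord_recr /=.
have -> : \sum_(i < j) a ^+ i + a ^+ j - j.+1%:Z
  = (\sum_(i < j) a ^+ i - j%:Z) + (a ^+ j - 1) by rewrite -addn1 PoszD; ring.
by rewrite rpredD // subrX1 dvdz_mulr.
Qed.

(* (1 + p c)^i = 1 + i p c mod p^2, and p divides p (p - 1) / 2 for odd p. *)
Lemma sum_expr_mod_sqr (p : nat) (a : int) : odd p -> (p%:Z %| a - 1)%Z ->
  (p%:Z ^+ 2 %| \sum_(i < p) a ^+ i - p%:Z)%Z.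
Proof.
move=> p_odd pa.
have pw i : (p%:Z ^+ 2 %| a ^+ i - (1 + i%:Z * (a - 1)))%Z.
  have [r] := horner_taylor2 ('X^i) 1 (a - 1).
  rewrite addrC subrK derivXn hornerMn !hornerXn !expr1n => ->.
  have -> : 1 + (a - 1) * (1 *+ i) + (a - 1) ^+ 2 * r - (1 + i%:Z * (a - 1))
          = (a - 1) ^+ 2 * r by rewrite natz; ring.
  by apply: dvdz_mulr; apply: dvdz_exp2r.
apply: (@dvdz_sub_trans _ (\sum_(i < p) (1 + i%:Z * (a - 1)))).
  by rewrite -sumrB; apply: rpred_sum => i _; apply: pw.
rewrite big_split /= sumr_const card_ord -mulr_suml addrAC natz subrr add0r.
have -> : \sum_(i < p) i%:Z = p%:Z * p.-1./2%:Z.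
  have -> : \sum_(i < p) i%:Z = (\sum_(i < p) i)%N%:Z.
    by rewrite -natz natr_sum; apply: eq_bigr => i _; rewrite natz.
  rewrite -PoszM; congr Posz; rewrite -(big_mkord xpredT id) bin2_sum bin2odd //.
by rewrite -mulrA expr2 dvdz_mul ?dvdz_mull.
Qed.

(** * Growth at an integer point *)

(** Growth without the quotient b_n: for g = f^k the last clause says that p does not divide b_n.
    Here g and y are arbitrary, so the condition can be moved along orbits and passed to g^p. *)
Definition grows_at (p : nat) (g : {poly int}) (n : nat) (y : int) : bool :=
  [&& (p%:Z ^+ n %| g.[y] - y)%Z, (p%:Z %| g^`().[y] - 1)%Z
    & ~~ (p%:Z ^+ n.+1 %| g.[y] - y)%Z].

Section GrowsAt.

Variables (p : nat) (p_prime : prime p) (n : nat) (n_gt0 : (0 < n)%N).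
Implicit Types (f g : {poly int}) (x y : int).

Lemma p_dvd_pXn (z : int) : (p%:Z ^+ n %| z)%Z -> (p%:Z %| z)%Z.
Proof. by apply: dvdz_trans; apply: dvdz_exp. Qed.

Lemma dvdz_pXS_sqr (z : int) :
  ((p%:Z ^+ n) ^+ 2 %| z)%Z -> (p%:Z ^+ n.+1 %| z)%Z.
Proof.
apply: dvdz_trans.
by rewrite -exprM dvdz_exp2l // muln2 -addnn -addn1 leq_add2l.
Qed.

Lemma p_neq0 : p%:Z != 0.
Proof. by have := prime_gt0 p_prime; case: (p). Qed.

Lemma iterp_grows_at g j y : grows_at p g n y ->
  (p%:Z ^+ n.+1 %| (iterp g j).[y] - (y + j%:Z * (g.[y] - y)))%Z.
Proof.
case/and3P=> qgy pa _.
apply: dvdz_sub_trans (dvdz_pXS_sqr (iterp_geometric j qgy)) _.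
set S := \sum_(i < j) _.
have -> : y + (g.[y] - y) * S - (y + j%:Z * (g.[y] - y))
   = (g.[y] - y) * (S - j%:Z) by ring.
by rewrite exprSr dvdz_mul // sum_expr_mod.
Qed.

(** Independence of the representative: g(y) - y and g(x) - x differ by (y - x)(g'(x) - 1) plus a
    multiple of (y - x)^2, both zero mod p^(n+1). *)
Lemma grows_at_congr g x y : (p%:Z ^+ n %| y - x)%Z ->
  grows_at p g n x -> grows_at p g n y.
Proof.
move=> qyx /and3P[qgx pa bx].
have pyx := p_dvd_pXn qyx.
have key : (p%:Z ^+ n.+1 %| (g.[y] - y) - (g.[x] - x))%Z.
  have [r] := horner_taylor2 g x (y - x); rewrite addrC subrK => ->.
  have -> : g.[x] + (y - x) * g^`().[x] + (y - x) ^+ 2 * r - y - (g.[x] - x)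
    = (y - x) * (g^`().[x] - 1) + (y - x) ^+ 2 * r by ring.
  apply: rpredD; first by rewrite exprSr dvdz_mul.
  by rewrite dvdz_mulr // dvdz_pXS_sqr // dvdz_exp2r.
apply/and3P; split.
- rewrite -(subrK (g.[x] - x) (_ - y)) rpredD //.
  by apply: dvdz_trans key; rewrite dvdz_exp2l.
- by apply: dvdz_sub_trans pa; apply: dvdz_horner_sub.
- apply: contra bx => b; rewrite -(subKr (g.[y] - y) (_ - x)).
  by rewrite rpredB.
Qed.

Lemma iterp_congr_fix g j y : (p%:Z ^+ n %| g.[y] - y)%Z ->
  (p%:Z ^+ n %| (iterp g j).[y] - y)%Z.
Proof.
move=> qgy; elim: j => [|j IHj]; first by rewrite iterp0_horner subrr.
rewrite iterpS_horner.
by apply: dvdz_sub_trans qgy; apply: dvdz_horner_sub.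
Qed.

(** The heart of the proof: the displacement of g^p is p times that of g modulo p^(n+2), so b mod p
    is unchanged from level n to level n+1. *)
Lemma grows_at_iterp_prime g y : odd p -> (1 < n)%N -> grows_at p g n y ->
  grows_at p (iterp g p) n.+1 y.
Proof.
move=> p_odd n_gt1 gy; have /and3P[qgy pa b] := gy.
have key : (p%:Z ^+ n.+2 %| ((iterp g p).[y] - y) - p%:Z * (g.[y] - y))%Z.
  rewrite -addrA -opprD.
  apply: (@dvdz_sub_trans _ (y + (g.[y] - y) * \sum_(i < p) g^`().[y] ^+ i)).
    apply: dvdz_trans (iterp_geometric p qgy).
    (* This is where n >= 2 enters: 2n >= n + 2. *)
    by rewrite -exprM dvdz_exp2l //; lia.
  set S := \sum_(i < p) _.
  have -> : y + (g.[y] - y) * S - (y + p%:Z * (g.[y] - y))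
     = (g.[y] - y) * (S - p%:Z) by ring.
  by rewrite -addn2 exprD dvdz_mul // sum_expr_mod_sqr.
apply/and3P; split.
- rewrite -(subrK (p%:Z * (g.[y] - y)) (_ - y)) rpredD //.
    by apply: dvdz_trans key; rewrite dvdz_exp2l.
  by rewrite exprS dvdz_mul.
(* By the chain rule the derivative of g^j at y is a product of values of g' at points congruent to
   y mod p, each 1 mod p. *)
- have : forall j, (p%:Z %| (iterp g j)^`().[y] - 1)%Z.
    elim=> [|j IHj]; first by rewrite /iterp /= derivX hornerC subrr.
    rewrite -addn1 addnC deriv_iterpD iterp1.
    set u := g^`().[_]; set v := _^`().[y].
    have -> : u * v - 1 = (u - 1) * v + (v - 1) by ring.
    rewrite rpredD // dvdz_mulr //.
    apply: dvdz_sub_trans pa; apply: dvdz_horner_sub.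
    exact/p_dvd_pXn/iterp_congr_fix.
  exact.
- apply: contra b => b.
  rewrite -(dvdz_mul2l p_neq0) -exprS.
  rewrite -(subKr ((iterp g p).[y] - y) (_ * _)).
  by rewrite rpredB.
Qed.

(* f' is invertible mod p along the orbit because its product there is 1, so
   it cancels from the derivative of f o f^k = f^k o f. *)
Lemma grows_at_horner f k y : (0 < k)%N ->
  grows_at p (iterp f k) n y -> grows_at p (iterp f k) n f.[y].
Proof.
case: k => // k _ gy; have /and3P[qgy pa b] := gy.
set g := iterp f k.+1 in gy qgy pa b *.
have gf : g.[f.[y]] = f.[g.[y]].
  by rewrite -iterpS_horner -addn1 iterpD_horner iterp1.
apply/and3P; split.
- by rewrite gf; apply: dvdz_horner_sub.
- have chain : g^`().[f.[y]] * f^`().[y] = f^`().[g.[y]] * g^`().[y].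
    have := deriv_iterpD f k.+1 1 y.
    by rewrite addnC deriv_iterpD !iterp1.
  have ga : g^`().[y] = (iterp f k)^`().[f.[y]] * f^`().[y].
    by rewrite /g -addn1 deriv_iterpD iterp1.
  set u := f^`().[y] in chain ga *.
  set w := (iterp f k)^`().[_] in ga.
  set v := f^`().[g.[y]] in chain.
  have pvu : (p%:Z %| v - u)%Z by apply: dvdz_horner_sub; apply: p_dvd_pXn.
  set A := g^`().[f.[y]] in chain *; set a := g^`().[y] in chain ga pa.
  (* Since a = w u and A u = v a, the term with factor w equals (A - 1) a. Both v - u and a - 1 are
     divisible by p. *)
  have -> : A - 1 = w * ((v - u) * a + u * (a - 1)) - (A - 1) * (a - 1).
    have : w * (A * u) = w * (v * a) by rewrite chain.
    have -> : w * (A * u) = A * a by rewrite ga; ring.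
    move=> e.
    have -> : w * ((v - u) * a + u * (a - 1)) = w * (v * a) - w * u
      by ring.
    rewrite -e -ga; ring.
  apply: rpredB; apply: dvdz_mull => //.
  by apply: rpredD; [apply: dvdz_mulr | apply: dvdz_mull].
(* If f(y) were fixed by g mod p^(n+1), applying [iterp f k] would make g(y) fixed too. But growth
   holds at g(y), which is congruent to y mod p^n. *)
- apply/negP => b'.
  have /and3P[_ _ /negP] := grows_at_congr qgy gy; apply.
  have -> : g.[y] = (iterp f k).[f.[y]].
    by rewrite /g -addn1 iterpD_horner iterp1.
  rewrite -{1}iterpD_horner addnC iterpD_horner.
  exact: dvdz_horner_sub.
Qed.

Lemma grows_at_iterp f k i y : (0 < k)%N ->
  grows_at p (iterp f k) n y -> grows_at p (iterp f k) n (iterp f i).[y].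
Proof.
move=> k_gt0 gy; elim: i => [|i IHi]; first by rewrite iterp0_horner.
by rewrite iterpS_horner grows_at_horner.
Qed.

(** * Exact periods modulo powers of p *)

(** A single equivalence encodes both the return after k steps and minimality; it also determines k
    by antisymmetry of divisibility. *)
Definition has_period (f : {poly int}) (q : int) (k : nat) (x : int) : Prop :=
  forall m, (q %| (iterp f m).[x] - x)%Z = (k %| m)%N.

Lemma has_period_iterp f (q : int) k i x y : (0 < k)%N ->
  (q %| y - (iterp f i).[x])%Z -> has_period f q k x -> has_period f q k y.
Proof.
move=> k_gt0 qy kx m.
have qym : (q %| (iterp f m).[y] - (iterp f (m + i)).[x])%Z.
  by rewrite iterpD_horner; apply: dvdz_horner_sub.
have qx : (q %| (iterp f m).[y] - y)%Z
        = (q %| (iterp f (m + i)).[x] - (iterp f i).[x])%Z.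
  apply/idP/idP => h.
    apply: dvdz_sub_trans qy; apply: dvdz_sub_trans h.
    by rewrite dvdz_subC.
  apply: (dvdz_sub_trans qym); apply: (dvdz_sub_trans h).
  by rewrite dvdz_subC.
rewrite {}qx -[RHS]kx; apply/idP/idP => h.
  (* From f^i(x), k i - i further steps lead back to x modulo q, as k i is a multiple of the
     period. *)
  have := dvdz_horner_sub (iterp f (k * i - i)) h.
  rewrite -!iterpD_horner addnC -addnA subnKC ?leq_pmull // => h'.
  have ki j : (k %| j)%N -> (q %| (iterp f j).[x] - x)%Z by rewrite kx.
  rewrite iterpD_horner in h'.
  apply: (@dvdz_sub_trans _ (iterp f m).[(iterp f (k * i)).[x]]).
    by apply: dvdz_horner_sub; rewrite dvdz_subC ki ?dvdn_mulr.
  apply: (dvdz_sub_trans h').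
  by rewrite subnK ?leq_pmull // ki ?dvdn_mulr.
by rewrite addnC iterpD_horner; apply: dvdz_horner_sub.
Qed.

(** A return mod p^(n+1) is a return mod p^n, so it takes j k steps for some j. The displacement is
    then j (g(y) - y) mod p^(n+1), where g = f^k, and it vanishes exactly when p divides j. *)
Lemma has_period_lift f k y : has_period f (p%:Z ^+ n) k y ->
  grows_at p (iterp f k) n y -> has_period f (p%:Z ^+ n.+1) (p * k) y.
Proof.
move=> ky gy m.
have [/dvdnP[j ->]|km] := boolP (k %| m)%N; last first.
  apply/idP/idP => h; case/negP: km.
    by rewrite -ky; apply: dvdz_trans h; rewrite dvdz_exp2l.
  by apply: dvdn_trans h; rewrite dvdn_mull.
have [k0|k_gt0] := posnP k.
  by case/and3P: gy => _ _; rewrite k0 iterp0_horner subrr dvdz0.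
rewrite dvdn_pmul2r // iterpM.
have gj := iterp_grows_at j gy; have /and3P[qgy _ b] := gy.
set g := iterp f k in gy gj qgy b *.
have -> : (iterp g j).[y] - y = j%:Z * (g.[y] - y)
          + ((iterp g j).[y] - (y + j%:Z * (g.[y] - y))) by ring.
rewrite rpredDr //.
case/dvdzP: qgy b => c ->; rewrite exprS.
have qn0 : p%:Z ^+ n != 0 by rewrite expf_neq0 // p_neq0.
rewrite mulrA !dvdz_mul2r // !dvdzE abszM !absz_nat => /negPf pc.
by rewrite Euclid_dvdM // pc orbF.
Qed.

End GrowsAt.

(** * Residue classes, and cycles in finite types *)

Lemma intr_Zp_eq (q : nat) (x y : int) : (1 < q)%N ->
  (x%:~R == y%:~R :> 'Z_q) = (q%:Z %| x - y)%Z.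
Proof.
move=> q_gt1; rewrite -subr_eq0 -intrB dvdzE.
have nat0 m : (m%:R == 0 :> 'Z_q) = (q %| m)%N.
  by rewrite -val_eqE /= val_Zp_nat.
case: (x - y) => m; first by rewrite -nat0.
by rewrite NegzE rmorphN oppr_eq0 abszN -nat0.
Qed.

Section FiniteCycle.

Variables (T : finType) (phi : T -> T).

Lemma ufcycle_trajectP (x : T) (k : nat) : (0 < k)%N ->
  ufcycle phi (traject phi x k) <->
  (forall m, (iter m phi x == x) = (k %| m)%N).
Proof.
case: k => // k _; split => [/andP[fc fu] m|per].
  have xin : x \in traject phi x k.+1 by rewrite mem_head.
  have ok : order phi x = k.+1 by rewrite (order_cycle fc fu xin) size_traject.
  have perx j : iter (j * k.+1) phi x = x.
    by elim: j => // j IHj; rewrite mulSn iterD IHj -ok (iter_order_cycle fc).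
  rewrite {1}(divn_eq m k.+1) addnC iterD perx /dvdn.
  have := ltn_pmod m (ltn0Sn k); set r := (m %% k.+1)%N => rk.
  have := @nth_uniq _ x _ r 0 _ _ fu; rewrite size_traject nth_traject //.
  exact.
apply/andP; split.
  rewrite trajectS (cycle_path x) /= last_traject -iterS per dvdnn.
  exact: fpath_traject.
rewrite looping_uniq; apply/negP => /trajectP[i ik e].
(* A repetition would yield the return time 2k + 1 - i, strictly between k + 1 and 2(k + 1). *)
have : iter (k.+1 - i + k) phi x == x.
  by rewrite iterD e -iterD subnK ?per //; lia.
by rewrite per => /dvdnP[[|[|j]]]; lia.
Qed.

(** Both cycles list the orbit of the common point z, hence agree once c1 is rotated to start at the
    first element of c2. *)
Lemma ufcycle_rot (c1 c2 : seq T) z : ufcycle phi c1 -> ufcycle phi c2 ->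
  z \in c1 -> z \in c2 -> exists r, c2 = rot r c1.
Proof.
move=> /andP[f1 u1] /andP[f2 u2] z1 z2.
have z12 : orbit phi z = rot (index z c2) c2 by rewrite (orbitE f2 u2 z2).
case: c2 => [|w c2] // in f2 u2 z2 z12 *.
have wc1 : w \in c1.
  by rewrite -(fconnect_cycle f1 z1) (fconnect_cycle f2 z2) mem_head.
exists (index w c1); rewrite -(orbitE f1 u1 wc1) (orbitE f2 u2 (mem_head _ _)).
by rewrite /= eqxx rot0.
Qed.

End FiniteCycle.

(** * Cycles of f_n in terms of integer orbits *)

Section Cycle.

Variables (p : nat) (p_prime : prime p) (f : {poly int}).

Section Level.

Variables (n : nat) (n_gt0 : (0 < n)%N).

Lemma iter_fmod m (x : int) :
  iter m (@fmod f p n) x%:~R = (iterp f m).[x]%:~R :> 'Z_(p ^ n).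
Proof.
elim: m => [|m IHm]; first by rewrite iterp0_horner.
by rewrite iterS IHm iterpS_horner /fmod horner_map.
Qed.

Lemma intr_ZpX_eq (x y : int) :
  (x%:~R == y%:~R :> 'Z_(p ^ n)) = (p%:Z ^+ n %| x - y)%Z.
Proof.
have q_gt1 : (1 < p ^ n)%N by rewrite -(expn0 p) ltn_exp2l ?prime_gt1.
by rewrite intr_Zp_eq // -natz natrX natz.
Qed.

Lemma is_cycleP (s : seq int) : is_cycle f p n s <->
  [/\ s <> [::],
      residues p n s = traject (@fmod f p n) (head 0 s)%:~R (size s)
    & has_period f (p%:Z ^+ n) (size s) (head 0 s)].
Proof.
case: s => [|x s]; first by split=> -[].
have per : has_period f (p%:Z ^+ n) (size s).+1 x <->
    (forall m, (iter m (@fmod f p n) x%:~R == x%:~R) = ((size s).+1 %| m)%N).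
  by split=> h m; move: (h m); rewrite iter_fmod intr_ZpX_eq.
split=> [[_ cyc]|[_ res /per/ufcycle_trajectP cyc]].
  have res : residues p n (x :: s) = traject (@fmod f p n) x%:~R (size s).+1.
    have /andP[fc _] := cyc.
    by have /= := fcycle_consE fc; rewrite size_map.
  split=> //; rewrite res in cyc.
  by apply/per/ufcycle_trajectP.
by split=> //; rewrite res; apply: cyc.
Qed.

(** On a cycle the division defining b_n is exact, so p divides b_n exactly when p^(n+1) divides the
    displacement. *)
Lemma growsP (s : seq int) : is_cycle f p n s ->
  grows f p n s <-> grows_at p (iterp f (size s)) n (head 0 s).
Proof.
case/is_cycleP=> _ _ /(_ (size s)); rewrite dvdnn => qD.
rewrite /grows /grows_at /cycle_a /cycle_b qD /= exprS.
have -> : (p ^ n)%N%:Z = p%:Z ^+ n by rewrite -natz natrX natz.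
have qn0 : p%:Z ^+ n != 0 by rewrite expf_neq0 // p_neq0.
case/dvdzP: qD => c ->; rewrite mulzK // dvdz_mul2r //.
have -> : (p%:Z %| c)%Z = (c == 0 %[mod p%:Z])%Z by rewrite eqz_mod_dvd subr0.
rewrite -eqz_mod_dvd.
by split=> [[/eqP-> /eqP]|/andP[/eqP-> /eqP]].
Qed.

Lemma iter_fmod_mem (s : seq int) i (x : int) : is_cycle f p n s ->
  x%:~R \in residues p n s -> (iterp f i).[x]%:~R \in residues p n s.
Proof.
case=> _ /andP[fc _] xs.
by rewrite -iter_fmod -(fconnect_cycle fc xs) fconnect_iter.
Qed.

Lemma residues_traject m (x : int) :
  residues p n (traject (horner f) x m) = traject (@fmod f p n) x%:~R m.
Proof.
elim: m x => //= m IHm x.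
by rewrite IHm /fmod horner_map.
Qed.

Lemma mem_residues (s : seq int) (y : int) : is_cycle f p n s ->
  y%:~R \in residues p n s ->
  exists i, (p%:Z ^+ n %| y - (iterp f i).[head 0 s])%Z.
Proof.
case/is_cycleP=> _ -> _ /trajectP[i _ /eqP].
by rewrite iter_fmod intr_ZpX_eq; exists i.
Qed.

Lemma head_mem_residues (s : seq int) :
  s <> [::] -> (head 0 s)%:~R \in residues p n s.
Proof. by case: s => // x s _; rewrite mem_head. Qed.

(** Used for uniqueness of the lift. With z = x + c p^n and g(x) = x + b p^n, it suffices to solve j
    b = c mod p, and b is invertible mod p. *)
Lemma grows_at_reach (g : {poly int}) (x z : int) :
  (p%:Z ^+ n %| z - x)%Z -> grows_at p g n x ->
  exists j, (p%:Z ^+ n.+1 %| (iterp g j).[x] - z)%Z.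
Proof.
move=> /dvdzP[c zx] gx; have /and3P[/dvdzP[b gxx] _ nb] := gx.
have qn0 : p%:Z ^+ n != 0 by rewrite expf_neq0 // p_neq0.
have /coprimezP[[u v] /= uv] : coprimez p%:Z b.
  rewrite /coprimez /gcdz -[_ == 1]/(coprime p `|b|) prime_coprime //.
  by move: nb; rewrite gxx exprS dvdz_mul2r // dvdzE.
have jE : `|(v * c %% p)%Z|%N%:Z = v * c - (v * c %/ p)%Z * p.
  by rewrite gez0_abs ?modz_ge0 ?p_neq0.
(* The Bezout coefficient v inverts b mod p; reducing v c mod p makes j a natural number. *)
exists `|(v * c %% p)%Z|%N.
apply: dvdz_sub_trans (iterp_grows_at n_gt0 _ gx) _.
rewrite jE gxx -(subrK x z) zx exprS.
have -> : x + (v * c - (v * c %/ p)%Z * p) * (b * p%:Z ^+ n) - (c * p%:Z ^+ n + x)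
    = (p%:Z * (- ((v * c %/ p)%Z * b) - c * u)
       + c * (u * p%:Z + v * b - 1)) * p%:Z ^+ n by ring.
by rewrite uv subrr mulr0 addr0 dvdz_mul // dvdz_mulr.
Qed.

End Level.

(** * Lifts of a growing cycle *)

Variables (n : nat) (n_gt0 : (0 < n)%N) (s : seq int).
Hypotheses (s_cycle : is_cycle f p n s) (s_grows : grows f p n s).

Let k := size s.
Let x := head 0 s.

Let k_gt0 : (0 < k)%N.
Proof. by case: s_cycle => + _; rewrite /k; case: s. Qed.

Let period_s : has_period f (p%:Z ^+ n) k x.
Proof. by case/(is_cycleP n_gt0): s_cycle. Qed.

Let grows_s : grows_at p (iterp f k) n x.
Proof. exact/(growsP n_gt0). Qed.

Lemma lift_head (t : seq int) : is_lift f p n s t ->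
  exists i, (p%:Z ^+ n %| head 0 t - (iterp f i).[x])%Z.
Proof.
case=> -[t0 _] ts; apply: mem_residues s_cycle (ts _ _) => //.
exact: head_mem_residues.
Qed.

Lemma lift_grows_at (t : seq int) : is_lift f p n s t ->
  grows_at p (iterp f k) n (head 0 t).
Proof.
case/lift_head=> i yi; apply: (grows_at_congr n_gt0 yi).
exact: (grows_at_iterp n_gt0).
Qed.

(** Both [size t] and p k are exact periods of the head of t mod p^(n+1), so they divide each
    other. *)
Lemma size_lift (t : seq int) : is_lift f p n s t -> size t = (p * k)%N.
Proof.
move=> lt; have [i yi] := lift_head lt.
have py : has_period f (p%:Z ^+ n) k (head 0 t) by apply: has_period_iterp yi _.
have pt := has_period_lift p_prime n_gt0 py (lift_grows_at lt).
have [/(is_cycleP (ltn0Sn n))[_ _ pt'] _] := lt.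
by apply/eqP; rewrite eqn_dvd -pt' pt dvdnn -pt pt' dvdnn.
Qed.

Lemma lift_grows (t : seq int) : odd p -> (1 < n)%N -> is_lift f p n s t ->
  grows f p n.+1 t.
Proof.
move=> p_odd n_gt1 lt; apply/(growsP (ltn0Sn n)); first by case: lt.
by rewrite (size_lift lt) iterpM grows_at_iterp_prime // lift_grows_at.
Qed.

Lemma growing_has_unique_lift : has_unique_lift f p n s.
Proof.
(* Existence: the integer orbit of x, cut at its period mod p^(n+1). *)
pose t := traject (horner f) x (p * k).
have pk_gt0 : (0 < p * k)%N by rewrite muln_gt0 prime_gt0.
have t_head : head 0 t = x by rewrite /t; case: (p * k)%N pk_gt0.
have t_cycle : is_cycle f p n.+1 t.
  apply/(is_cycleP (ltn0Sn n)).
  rewrite t_head size_traject residues_traject; split=> //.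
    by rewrite /t; case: (p * k)%N pk_gt0.
  exact: has_period_lift.
have xs : x%:~R \in residues p n s.
  by case: s_cycle => s0 _; apply: head_mem_residues.
exists t => [|t' lt'].
  split=> // y; rewrite residues_traject => /trajectP[i _ ->].
  by rewrite iter_fmod iter_fmod_mem.
have [t'_cycle _] := lt'; have [i yi] := lift_head lt'.
set y := head 0 t' in yi.
(* Uniqueness: y is moved along its own cycle into the class of x mod p^n. The resulting z is also
   met, mod p^(n+1), on the orbit of x after j k steps, so the two cycles share a point. *)
pose z := (iterp f (k * i - i)).[y].
have zx : (p%:Z ^+ n %| z - x)%Z.
  apply: dvdz_sub_trans (dvdz_horner_sub _ yi) _.
  by rewrite -iterpD_horner subnK ?leq_pmull // period_s dvdn_mulr.
have [j jz] := grows_at_reach n_gt0 zx grows_s.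
have [[t'0 t'c] [t0 tc]] := (t'_cycle, t_cycle).
apply: (@ufcycle_rot _ _ _ _ z%:~R tc t'c); last first.
  by apply: iter_fmod_mem => //; apply: head_mem_residues.
have -> : z%:~R = (iterp f (j * k)).[x]%:~R :> 'Z_(p ^ n.+1).
  by apply/eqP; rewrite eq_sym intr_ZpX_eq // iterpM.
by apply: iter_fmod_mem => //; rewrite -t_head; apply: head_mem_residues.
Qed.

End Cycle.

Theorem mainTheorem3 (p : nat) (f : {poly int}) (n : nat) (s : seq int)
    (p_prime : prime p) (p_odd : odd p) (n_ge2 : (2 <= n)%N)
    (s_cycle : is_cycle f p n s) (s_grows : grows f p n s) :
  [/\ has_unique_lift f p n s,
      forall t : seq int, is_lift f p n s t -> grows f p n.+1 t &
      forall (m : nat) (t : seq int), iterated_lift f p n s m t ->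
        grows f p (n + m)%N t /\ has_unique_lift f p (n + m)%N t].
Proof.
have n_gt0 : (0 < n)%N by apply: ltnW.
split=> [|t|m t lt]; first exact: growing_has_unique_lift.
  exact: lift_grows.
have nm_gt0 : (0 < n + m)%N by rewrite addn_gt0 n_gt0.
(* Being a growing cycle passes to each lift, and the level never drops below n >= 2. *)
suff [t_cycle t_grows] : is_cycle f p (n + m) t /\ grows f p (n + m) t.
  by split=> //; apply: growing_has_unique_lift.
elim: m t lt {nm_gt0} => [t /= ->|m IHm t /= [u lu ut]]; first by rewrite addn0.
have [u_cycle u_grows] := IHm u lu.
rewrite addnS; split; first by case: ut.
by apply: lift_grows ut; rewrite // ?addn_gt0 ?n_gt0 // ltn_addr.
Qed.
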